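(* Let $x\in E'=(0,1)\cap\mathbb{Q}$ and put $\varphi^{-1}(x)=\{\sigma,\sigma'\}$, where $\sigma\in\Sigma_n$ is realizable and $\sigma'\in\Sigma_{n+1}$ is not realizable, for some $n\in\mathbb{N}$. Write $x=[d_1(x),d_2(x),\dots,d_n(x)]_P$ for its (finite) Pierce expansion. Then the following hold. (i) If $n$ is odd, then $\mathcal{E}$ is left-continuous but has a right jump discontinuity at $x$; more precisely, $$\lim_{t\to x^-}\mathcal{E}(t)=\mathcal{E}^*(\sigma)=\mathcal{E}(x),$$ $$\lim_{t\to x^+}\mathcal{E}(t)=\mathcal{E}^*(\sigma')=\mathcal{E}(x)-\frac{1}{d_1(x)\cdots d_{n-1}(x)\,(d_n(x)-1)\,d_n(x)}.$$ (ii) If $n$ is even, then $\mathcal{E}$ is right-continuous but has a left jump discontinuity at $x$; more precisely, $$\lim_{t\to x^+}\mathcal{E}(t)=\mathcal{E}^*(\sigma)=\mathcal{E}(x),$$ $$\lim_{t\to x^-}\mathcal{E}(t)=\mathcal{E}^*(\sigma')=\mathcal{E}(x)+\frac{1}{d_1(x)\cdots d_{n-1}(x)\,(d_n(x)-1)\,d_n(x)}.$$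
   Context: Let $I=[0,1]$ and $\mathbb{N}_\infty=\mathbb{N}\cup\{\infty\}$ where $\mathbb{N}=\{1,2,3,\dots\}$, with the conventions $\infty+c=\infty$ and $c/\infty=0$ for $c\in\mathbb{R}$; a product of elements of $\mathbb{N}_\infty$ with a factor $\infty$ equals $\infty$; empty products equal $1$. Define $d_1\colon I\to\mathbb{N}_\infty$ and $T\colon I\to I$ by $d_1(x)=\lfloor 1/x\rfloor$, $T(x)=1-d_1(x)\,x$ for $x\neq 0$, and $d_1(0)=\infty$, $T(0)=0$. For $n\in\mathbb{N}$ let $d_n(x)=d_1(T^{n-1}x)$ (the Pierce expansion digits of $x$), and let $s_n(x)=\sum_{k=1}^n\frac{(-1)^{k+1}}{d_1(x)\cdots d_k(x)}$. The error-sum function of Pierce expansions is $\mathcal{E}\colon I\to\mathbb{R}$, $\mathcal{E}(x)=\sum_{n=1}^\infty (x-s_n(x))$ (absolutely and uniformly convergent). Writing $x=[d_1(x),\dots,d_n(x)]_P$ means that $d_1(x),\dots,d_n(x)<\infty$ and $d_k(x)=\infty$ for all $k>n$. Pierce sequences: $\Sigma_0=\{(\infty,\infty,\dots)\}$; for $n\in\mathbb{N}$, $\Sigma_n$ is the set of sequences $(\sigma_1,\dots,\sigma_n,\infty,\infty,\dots)$ with $\sigma_1<\dots<\sigma_n$ in $\mathbb{N}$; $\Sigma_\infty$ is the set of strictly increasing infinite sequences in $\mathbb{N}$; and $\Sigma=\bigcup_{n\ge0}\Sigma_n\cup\Sigma_\infty\subseteq\mathbb{N}_\infty^{\mathbb{N}}$.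 A sequence $\sigma\in\Sigma$ is realizable if there is $x\in I$ with $d_k(x)=\sigma_k$ for all $k\in\mathbb{N}$. For $\sigma=(\sigma_k)\in\Sigma$ let $\varphi(\sigma)=\sum_{k=1}^\infty\frac{(-1)^{k+1}}{\sigma_1\cdots\sigma_k}\in I$, $\varphi_n(\sigma)=\sum_{k=1}^n\frac{(-1)^{k+1}}{\sigma_1\cdots\sigma_k}$, and $\mathcal{E}^*(\sigma)=\sum_{n=1}^\infty(\varphi(\sigma)-\varphi_n(\sigma))$ (absolutely and uniformly convergent on $\Sigma$). It is known that for $x\in E'$ with finite Pierce expansion $[d_1(x),\dots,d_n(x)]_P$, $n\ge 1$, the set $\varphi^{-1}(x)$ consists of exactly the two sequences $\sigma=(d_1(x),\dots,d_n(x),\infty,\dots)\in\Sigma_n$ (realizable) and $\sigma'=(d_1(x),\dots,d_{n-1}(x),d_n(x)-1,d_n(x),\infty,\dots)\in\Sigma_{n+1}$ (not realizable). *)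

(* Defs.v *)
From HB Require Import structures.
From mathcomp Require Import all_boot all_order all_algebra.
From mathcomp Require Import all_classical all_reals all_analysis.
Set Implicit Arguments.
Unset Strict Implicit.
Unset Printing Implicit Defensive.
Import Order.TTheory GRing.Theory Num.Theory numFieldNormedType.Exports.
Local Open Scope classical_set_scope.
Local Open Scope ring_scope.

(* [None] is infinity. The type also contains [Some 0], which is not in
   N = {1, 2, ...}; [Sigma_fin] and [Sigma_inf] exclude it, and it is not a
   digit of any point of [0, 1]. *)
Definition Ninf := option nat.

Definition mulNinf (a b : Ninf) : Ninf :=
  if (a, b) is (Some m, Some n) then Some (m * n)%N else None.

(* a - 1, with infinity - 1 = infinity *)
Definition predNinf (a : Ninf) : Ninf := omap predn a.

(* 1 / a, with 1 / infinity = 0 *)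
Definition invNinf (R : realType) (a : Ninf) : R :=
  if a is Some n then n%:R^-1 else 0.

Lemma mulNinfA : associative mulNinf.
Proof. by rewrite /mulNinf => -[a|] [b|] [c|] //; rewrite mulnA. Qed.

Lemma mulNinfC : commutative mulNinf.
Proof. by rewrite /mulNinf => -[a|] [b|] //; rewrite mulnC. Qed.

Lemma mul1Ninf : left_id (Some 1%N) mulNinf.
Proof. by rewrite /mulNinf => -[a|] //; rewrite mul1n. Qed.

HB.instance Definition _ :=
  Monoid.isComLaw.Build Ninf (Some 1%N) mulNinf mulNinfA mulNinfC mul1Ninf.

(* For the sequences below, [s k] is the term of index k + 1. *)
Definition Nseq := nat -> Ninf.

(* \sum_(1 <= k <= n) (-1)^(k+1) / (s_1 ... s_k) and the corresponding series *)
Definition phi_term (R : realType) (s : Nseq) (k : nat) : R :=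
  (-1) ^+ k.+1 * invNinf R (\big[mulNinf/Some 1%N]_(0 <= i < k) s i).

Definition phi_part (R : realType) (s : Nseq) (n : nat) : R :=
  \sum_(1 <= k < n.+1) phi_term R s k.

Definition phi (R : realType) (s : Nseq) : R :=
  \big[+%R/0]_(1 <= k <oo) phi_term R s k.

Definition Estar (R : realType) (s : Nseq) : R :=
  \big[+%R/0]_(1 <= n <oo) (phi R s - phi_part R s n).

(* The functions of x are defined on all of R; only their values on [0, 1],
   where [Num.truncn x^-1] is the floor of 1 / x, are meaningful. *)
Definition d1 (R : realType) (x : R) : Ninf :=
  if x == 0 then None else Some (Num.truncn x^-1).

Definition pierceT (R : realType) (x : R) : R :=
  if d1 x is Some m then 1 - m%:R * x else 0.

(* d_n(x), for n >= 1 *)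
Definition digit (R : realType) (n : nat) (x : R) : Ninf :=
  d1 (iter n.-1 (@pierceT R) x).

Definition digits (R : realType) (x : R) : Nseq := fun k => digit k.+1 x.

Definition s_part (R : realType) (n : nat) (x : R) : R :=
  phi_part R (digits x) n.

Definition errsum (R : realType) (x : R) : R :=
  \big[+%R/0]_(1 <= n <oo) (x - s_part n x).

Definition finite_pierce (R : realType) (n : nat) (x : R) : Prop :=
  (forall k, (1 <= k <= n)%N -> digit k x <> None) /\
  (forall k, (n < k)%N -> digit k x = None).

Definition Sigma_fin (n : nat) : set Nseq :=
  [set s | exists a : nat -> nat,
    [/\ forall k, (k < n)%N -> (0 < a k)%N,
        forall i j, (i < j < n)%N -> (a i < a j)%N &
        forall k, s k = if (k < n)%N then Some (a k) else None]].

Definition Sigma_inf : set Nseq :=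
  [set s | exists a : nat -> nat,
    [/\ forall k, (0 < a k)%N,
        forall i j, (i < j)%N -> (a i < a j)%N &
        forall k, s k = Some (a k)]].

Definition Sigma : set Nseq := (\bigcup_n Sigma_fin n) `|` Sigma_inf.

Definition realizable (R : realType) (s : Nseq) : Prop :=
  exists2 x : R, 0 <= x <= 1 & forall k, digits x k = s k.

Definition phi_preimage (R : realType) (x : R) : set Nseq :=
  [set s | Sigma s /\ phi R s = x].

Definition rat_unit_interval (R : realType) : set R :=
  [set x : R | 0 < x < 1] `&` @rational R.

Definition left_continuous_at (R : realType) (f : R -> R) (x : R) : Prop :=
  f t @[t --> x^'-] --> f x.

Definition right_continuous_at (R : realType) (f : R -> R) (x : R) : Prop :=
  f t @[t --> x^'+] --> f x.

Definition left_jump_at (R : realType) (f : R -> R) (x : R) : Prop :=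
  exists2 l : R, f t @[t --> x^'-] --> l & l <> f x.

Definition right_jump_at (R : realType) (f : R -> R) (x : R) : Prop :=
  exists2 l : R, f t @[t --> x^'+] --> l & l <> f x.

(* 1 / (d_1(x) ... d_(n-1)(x) (d_n(x) - 1) d_n(x)) *)
Definition jump_size (R : realType) (n : nat) (x : R) : R :=
  invNinf R (mulNinf (mulNinf (\big[mulNinf/Some 1%N]_(1 <= k < n) digit k x)
                              (predNinf (digit n x)))
                     (digit n x)).

(* Main.v *)
Require Import Defs.
From mathcomp Require Import all_boot all_order all_algebra.
From mathcomp Require Import all_classical all_reals all_analysis.
From mathcomp Require Import ring lra zify.
Import Order.TTheory GRing.Theory Num.Theory numFieldNormedType.Exports.
Local Open Scope classical_set_scope.
Local Open Scope ring_scope.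

(** Write T for the Pierce map and E for the error-sum function. Deleting the
    first digit of an expansion gives x = (1 - T x) / d_1(x) and, for the
    remainders, x - s_(n+1)(x) = - (T x - s_n(T x)) / d_1(x). Summing over n
    yields the functional equation
      E(x) = - (T x + E(T x)) / d_1(x),
    [errsumS], valid once the series are known to converge; the same relation
    gives a geometric bound on the remainders, hence |E(x)| <= 2 x, so that E
    is continuous at 0.

    On the branch (1/(m+1), 1/m] of T, the digit d_1 is the constant m and
    T t = 1 - m t is affine and decreasing. So a limit of E at 1 - m x from
    one side gives a limit of E at x from the other side: this is
    [errsum_branch]. The one-sided limits at a point with a finite expansion
    follow by induction on its length ([errsum_limits]). If x has length at
    least 2, it is interior to a branch, both limits are pulled back from
    T x, and the jump is multiplied by -1/d_1(x), which is where the parity in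
    the theorem comes from. If x = 1/m, the branch of index m ends at x: from
    the left, T t tends to 0 from the right and E is continuous there. From
    the right, the branch has index m - 1 and sends x to 1 - (m-1)/m = x
    itself, with the sides exchanged; so the right limit is
    - (x + E(x)) / (m-1) = - 1 / ((m-1) m), because E(1/m) = 0.

    It remains to identify the two sequences over x. The realizable one is
    the digit sequence of x, because phi inverts the expansion
    ([phi_digits]). The other one replaces the last digit d by the two digits
    d - 1, d ([twin]); the identity 1/(d-1) - 1/((d-1) d) = 1/d shows that it
    is also sent to x, and it is a Pierce sequence because the last two digits
    of a finite expansion never are consecutive ([d1_last_gap]). The partial
    sums of the two sequences differ at one index only, so that the two values
    of Estar differ by the last term of the longer sum, which is the jump
    ([Estar_twin]). *)

(** * Deleting the first digit *)

Definition seq_tail (s : Nseq) : Nseq := fun k => s k.+1.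

Lemma invNinfM {R : realType} (a b : Ninf) :
  invNinf R (mulNinf a b) = invNinf R a * invNinf R b.
Proof.
by case: a b => [a|] [b|] /=; rewrite ?mul0r ?mulr0 // natrM invfM.
Qed.

Lemma phi_term_tail {R : realType} (s : Nseq) k :
  phi_term R s k.+1 = - (invNinf R (s 0%N) * phi_term R (seq_tail s) k).
Proof.
by rewrite /phi_term big_nat_recl // invNinfM exprS mulN1r mulNr mulrCA.
Qed.

Lemma phi_part_tail {R : realType} (s : Nseq) n :
  phi_part R s n.+1 = invNinf R (s 0%N) * (1 - phi_part R (seq_tail s) n).
Proof.
rewrite /phi_part big_add1 /= big_nat_recl // !phi_term_tail.
rewrite (_ : phi_term R _ 0 = -1); last first.
  by rewrite /phi_term big_geq //= expr1 invr1 mulr1.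
under eq_bigr do rewrite phi_term_tail.
rewrite sumrN -mulr_sumr (big_add1 _ _ 0%N n.+1) /=.
under eq_bigr do rewrite phi_term_tail.
by rewrite mulrN1 opprK mulrBr mulr1.
Qed.

Lemma digits_tail {R : realType} (x : R) :
  seq_tail (digits x) = digits (pierceT x).
Proof. by apply/funext => k; rewrite /seq_tail /digits /digit /= -iterSr. Qed.

(** * One step of the Pierce map *)

Lemma d1_0 {R : realType} : d1 (0 : R) = None.
Proof. by rewrite /d1 eqxx. Qed.

Lemma d1_eq_None {R : realType} (x : R) : d1 x = None -> x = 0.
Proof. by rewrite /d1; case: eqP. Qed.

Lemma pierceT_0 {R : realType} : pierceT (0 : R) = 0.
Proof. by rewrite /pierceT d1_0. Qed.

Lemma digits_0 {R : realType} k : digits (0 : R) k = None.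
Proof.
rewrite /digits /digit /= (_ : iter k _ _ = 0) ?d1_0 //.
by elim: k => //= k ->; rewrite pierceT_0.
Qed.

Lemma d1P {R : realType} (x : R) (m : nat) :
  0 < x -> d1 x = Some m <-> m%:R * x <= 1 < m.+1%:R * x.
Proof.
move=> x0; rewrite /d1 gt_eqF // -ler_pdivlMr // -ltr_pdivrMr // mul1r.
split=> [[<-]|h]; first by rewrite truncn_itv // invr_ge0 ltW.
by congr Some; apply: truncn_def.
Qed.

(** The last inequality says T x < 1/(d_1(x) + 1); it makes the digits increase
    and, at the end of an expansion, leaves a gap between them. *)
Lemma pierceT_itv {R : realType} (x : R) : 0 < x <= 1 ->
  exists2 m, d1 x = Some m.+1 & 
  [/\ pierceT x = 1 - m.+1%:R * x, 0 <= pierceT x, pierceT x < x &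
      m.+2%:R * pierceT x < 1].
Proof.
move=> /andP[x0 x1].
have dx : d1 x = Some (Num.truncn x^-1) by rewrite /d1 gt_eqF.
have /andP[h1 h2] := (d1P x _ x0).1 dx.
move: dx; rewrite /pierceT; case: (Num.truncn _) h1 h2 => [|m] h1 h2 dx.
  by move: h2; rewrite mul1r ltNge x1.
exists m => //; rewrite dx; split=> //.
- lra.
- by move: h2; rewrite -(@natr1 _ m.+1); lra.
- have : 0 < (m.+1%:R : R) by rewrite ltr0n.
  move: h2; rewrite -(@natr1 _ m.+1); nra.
Qed.

Lemma pierceT_half {R : realType} (x : R) :
  0 <= x <= 1 -> 0 <= pierceT x <= 2^-1.
Proof.
move=> /andP[]; rewrite le_eqVlt => /predU1P[<- _|x0 x1].
  by rewrite pierceT_0 lexx /= invr_ge0.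
have [|m _ [_ T0 _]] := pierceT_itv x; first by rewrite x0 x1.
rewrite -(@natr1 _ m.+1) -natr1 T0 /= => h.
have := ler0n R m; nra.
Qed.

Lemma pierceT01 {R : realType} (x : R) : 0 <= x <= 1 -> 0 <= pierceT x <= 1.
Proof. by move=> /pierceT_half /andP[-> h] /=; lra. Qed.

(** With 1/infinity = 0 the inversion formula also holds at 0. *)
Lemma pierceTK {R : realType} (x : R) : 0 <= x <= 1 ->
  x = invNinf R (d1 x) * (1 - pierceT x).
Proof.
move=> /andP[]; rewrite le_eqVlt => /predU1P[<- _|x0 x1].
  by rewrite d1_0 mul0r.
have [|m -> [-> _ _ _]] := pierceT_itv x; first by rewrite x0 x1.
by rewrite opprB addrC subrK mulKf // pnatr_eq0.
Qed.

(** * Convergence and the functional equation *)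
Definition remainder (R : realType) (n : nat) (x : R) : R := x - s_part n x.

Lemma remainderS {R : realType} (x : R) n : 0 <= x <= 1 ->
  remainder R n.+1 x = - (invNinf R (d1 x) * remainder R n (pierceT x)).
Proof.
move=> x01; rewrite /remainder /s_part {1}(pierceTK _ x01).
rewrite phi_part_tail digits_tail.
by rewrite [digits x 0%N]/(d1 x); ring.
Qed.

Lemma remainder0 {R : realType} (x : R) : remainder R 0 x = x.
Proof. by rewrite /remainder /s_part /phi_part big_geq // subr0. Qed.


Lemma invNinf_ge0 {R : realType} (a : Ninf) : 0 <= invNinf R a.
Proof. by case: a => [a|] //=; rewrite invr_ge0. Qed.

Lemma invNinf_d1_le1 {R : realType} (x : R) :
  0 <= x <= 1 -> invNinf R (d1 x) <= 1.
Proof.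
move=> /andP[]; rewrite le_eqVlt => /predU1P[<- _|x0 x1]; first by rewrite d1_0.
have [|m -> _] := pierceT_itv x; first by rewrite x0 x1.
by rewrite /= invf_le1 ?ltr0n // ler1n.
Qed.

Lemma invNinf_d1_half {R : realType} (x : R) :
  0 <= x <= 2^-1 -> invNinf R (d1 x) <= 2^-1.
Proof.
move=> /andP[]; rewrite le_eqVlt => /predU1P[<- _|x0 x2].
  by rewrite d1_0 invr_ge0.
have [|[|m] -> [-> _ h _]] := pierceT_itv x; first by rewrite x0 /=; lra.
  by move: h; rewrite mul1r; lra.
by rewrite /= lef_pV2 ?posrE ?ltr0n // ler_nat.
Qed.

Lemma pierceT_le {R : realType} (x : R) : 0 <= x <= 1 -> pierceT x <= x.
Proof.
move=> /andP[]; rewrite le_eqVlt => /predU1P[<- _|x0 x1].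
  by rewrite pierceT_0.
by have [|m _ [_ _ /ltW]] := pierceT_itv x; first by rewrite x0 x1.
Qed.

(** Below 1/2 the first digit is at least 2, and T keeps points there: each step
    halves the remainder. *)
Lemma remainder_half {R : realType} (x : R) n :
  0 <= x <= 2^-1 -> `|remainder R n x| <= x * 2^-1 ^+ n.
Proof.
elim: n x => [|n IH] x xh.
  by rewrite remainder0 mulr1 ger0_norm //; case/andP: xh.
have x01 : 0 <= x <= 1 by case/andP: xh => -> /=; lra.
rewrite remainderS // normrN normrM (ger0_norm (invNinf_ge0 _)) exprS mulrCA.
apply: ler_pM => //; [exact: invNinf_ge0|exact: invNinf_d1_half|].
apply: le_trans (IH _ (pierceT_half _ x01)) _.
by rewrite ler_wpM2r ?exprn_ge0 ?invr_ge0 // pierceT_le.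
Qed.

(** One step of T brings any point of the unit interval below 1/2. The factor x,
    obtained from T x <= x, makes E continuous at 0. *)
Lemma remainder_bound {R : realType} (x : R) n :
  0 <= x <= 1 -> `|remainder R n.+1 x| <= geometric x 2^-1 n.
Proof.
move=> x01; rewrite remainderS // normrN normrM (ger0_norm (invNinf_ge0 _)).
rewrite /geometric /= -[leRHS]mul1r.
apply: ler_pM => //; [exact: invNinf_ge0|exact: invNinf_d1_le1|].
apply: le_trans (remainder_half _ _ (pierceT_half _ x01)) _.
by rewrite ler_wpM2r ?exprn_ge0 ?invr_ge0 // pierceT_le.
Qed.

(** The series of the problem start at index 1, and [\sum_(1 <= k < n)] stops
    before n; hence the shift. *)
Lemma lim_sum_from1 {R : realType} (F : nat -> R) (l : R) :
  (\sum_(1 <= k < n.+1) F k) @[n --> \oo] --> l ->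
  \big[+%R/0]_(1 <= k <oo) F k = l.
Proof.
move=> h; apply/cvg_lim; first exact: norm_hausdorff.
by rewrite -cvg_shiftS.
Qed.

Lemma norm_half_lt1 (R : realType) : `|2^-1 : R| < 1.
Proof. by rewrite gtr0_norm ?invr_gt0 // invf_lt1 // ltr1n. Qed.

Lemma remainder_normed_cvg {R : realType} (x : R) : 0 <= x <= 1 ->
  cvgn [normed series (fun k => remainder R k.+1 x)].
Proof.
move=> x01; have h2 := norm_half_lt1 R.
apply: (@series_le_cvg R _ (geometric x 2^-1)).
- by move=> n; exact: normr_ge0.
- move=> n; rewrite /geometric /= mulr_ge0 ?exprn_ge0 ?invr_ge0 //.
  by case/andP: x01.
- by move=> n; exact: remainder_bound.
- exact: is_cvg_geometric_series.
Qed.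

Lemma errsum_cvg {R : realType} (x : R) : 0 <= x <= 1 ->
  series (fun k => remainder R k.+1 x) @ \oo --> errsum x.
Proof.
move=> x01; have c := normed_cvg (remainder_normed_cvg _ x01).
rewrite (_ : errsum x = limn (series (fun k => remainder R k.+1 x))) //.
apply: lim_sum_from1.
rewrite (_ : (fun n => _) = series (fun k => remainder R k.+1 x)) //.
by apply/funext => n; rewrite big_add1.
Qed.

Lemma errsum_bound {R : realType} (x : R) : 0 <= x <= 1 -> `|errsum x| <= 2 * x.
Proof.
move=> x01; have h2 := norm_half_lt1 R.
have c := remainder_normed_cvg _ x01.
rewrite -(cvg_lim _ (errsum_cvg _ x01)) //.
apply: le_trans (lim_series_norm c) _.
apply: le_trans (lim_series_le c (is_cvg_geometric_series h2)
  (remainder_bound _ ^~ x01)) _.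
rewrite (cvg_lim _ (cvg_geometric_series h2)) //.
by rewrite (_ : 1 - 2^-1 = 2^-1 :> R) ?invrK ?[2 * x]mulrC //; lra.
Qed.

Lemma errsumS {R : realType} (x : R) : 0 <= x <= 1 ->
  errsum x = - (invNinf R (d1 x) * (pierceT x + errsum (pierceT x))).
Proof.
move=> x01; have y01 := pierceT01 _ x01.
have := errsum_cvg _ x01; rewrite -cvg_shiftS => cx.
rewrite -(cvg_lim _ cx) //; apply/cvg_lim => //.
rewrite (_ : (fun n => _) = fun n => - (invNinf R (d1 x) *
  (pierceT x + series (fun k => remainder R k.+1 (pierceT x)) n))); last first.
  apply/funext => n; rewrite /series /= big_nat_recl //.
  rewrite remainderS // remainder0.
  under eq_bigr do rewrite remainderS //.
  by rewrite sumrN -mulr_sumr mulrDr opprD.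
apply: cvgN; apply: cvgMr; apply: cvgD; [exact: cvg_cst|exact: errsum_cvg].
Qed.

Lemma phi_digits {R : realType} (x : R) : 0 <= x <= 1 -> phi R (digits x) = x.
Proof.
move=> x01; apply: lim_sum_from1; rewrite -/(phi_part R (digits x) _).
have h : remainder R n.+1 x @[n --> \oo] --> 0.
  exact: cvg_series_cvg_0 (normed_cvg (remainder_normed_cvg _ x01)).
rewrite -cvg_shiftS (_ : (fun n => _) = fun n => x - remainder R n.+1 x).
  suff : x - remainder R n.+1 x @[n --> \oo] --> x - 0 by rewrite subr0.
  by apply: cvgB => //; exact: cvg_cst.
by apply/funext => n; rewrite /remainder opprB addrC subrK.
Qed.

(** * One-sided limits *)

(** A boolean names the side, because T exchanges the two sides at each step. *)
Definition at_side {R : realType} (left : bool) (x : R) : set_system R :=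
  if left then x^'- else x^'+.

#[local] Instance at_side_filter {R : realType} b (x : R) :
  ProperFilter (at_side b x).
Proof. by case: b; rewrite /at_side; exact: _. Qed.

(** The points close to x on side b lie in (1/(m+1), 1/m]: x may be the right
    end of this interval when it is approached from the left, and its left end
    when it is approached from the right. *)
Definition side_in_branch {R : realType} (b : bool) (x : R) (m : nat) : bool :=
  if b then m%:R * x <= 1 < m.+1%:R * x else m%:R * x < 1 <= m.+1%:R * x.

Lemma near_d1 {R : realType} b (x : R) m : (0 < m)%N ->
  side_in_branch b x m ->
  \forall t \near at_side b x, 0 <= t <= 1 /\ d1 t = Some m.
Proof.
move=> m0.
have mp : 0 < (m%:R : R) by rewrite ltr0n.
have m1 : 1 <= (m%:R : R) by rewrite ler1n.
case: b; rewrite /at_side /side_in_branch -natr1 => /andP[h1 h2].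
- have sx : m.+1%:R^-1 < x.
    by rewrite -natr1 -div1r ltr_pdivrMr ?addr_gt0 // mulrC.
  near=> t.
  have tx : t < x by near: t; exact: nbhs_left_lt.
  have st : m.+1%:R^-1 < t by near: t; exact: nbhs_left_gt.
  have t0 : 0 < t by apply: lt_trans st; rewrite invr_gt0 ltr0n.
  move: st; rewrite -div1r ltr_pdivrMr ?ltr0n // => st.
  split; first by apply/andP; split; nra.
  by apply/(d1P t m t0); rewrite [_.+1%:R * t]mulrC st andbT; nra.
- have xs : x < m%:R^-1 by rewrite -div1r ltr_pdivlMr // mulrC.
  have x0 : 0 < x by nra.
  near=> t.
  have xt : x < t by near: t; exact: nbhs_right_gt.
  have ts : t < m%:R^-1 by near: t; exact: nbhs_right_lt.
  have t0 : 0 < t by exact: lt_trans xt.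
  move: ts; rewrite -div1r ltr_pdivlMr // => ts.
  split; first by apply/andP; split; nra.
  by apply/(d1P t m t0); rewrite -natr1; apply/andP; split; nra.
Unshelve. all: by end_near. Qed.

Lemma affine_at_side {R : realType} b (x : R) m : (0 < m)%N ->
  (1 - m%:R * t) @[t --> at_side b x] --> at_side (~~ b) (1 - m%:R * x).
Proof.
move=> m0; have mp : 0 < (m%:R : R) by rewrite ltr0n.
have c : (1 - m%:R * t) @[t --> at_side b x] --> 1 - m%:R * x.
  have c : (1 - m%:R * t) @[t --> x] --> 1 - m%:R * x.
    by apply: cvgB; [exact: cvg_cst|apply: cvgMr; exact: cvg_id].
  case: b; rewrite /at_side; first exact: cvg_at_left_filter.
  exact: cvg_at_right_filter.
move=> A hA; rewrite /fmap /= nbhs_filterE.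
suff [D hD near_D] : exists2 D : set R,
    nbhs (1 - m%:R * x) (fun y => D y -> A y) &
    \forall t \near at_side b x, D (1 - m%:R * t).
  by have hc := c _ hD; near=> t; apply: (near hc t) => //; near: t.
case: b hA {c} => hA.
- exists (fun y => y > 1 - m%:R * x) => //; rewrite /at_side.
  near=> t; have tx : t < x by near: t; exact: nbhs_left_lt.
  nra.
- exists (fun y => y < 1 - m%:R * x) => //; rewrite /at_side.
  near=> t; have tx : x < t by near: t; exact: nbhs_right_gt.
  nra.
Unshelve. all: by end_near. Qed.

(** The functional equation passes to the limit along one branch of T. *)
Lemma errsum_branch {R : realType} b (x l : R) m : (0 < m)%N ->
  side_in_branch b x m ->
  errsum t @[t --> at_side (~~ b) (1 - m%:R * x)] --> l ->
  errsum t @[t --> at_side b x] --> - (m%:R^-1 * (1 - m%:R * x + l)).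
Proof.
move=> m0 hm cl; have nd := near_d1 b x m m0 hm.
have ca := affine_at_side b x m m0.
apply: cvg_trans (_ : - (m%:R^-1 * (1 - m%:R * t + errsum (1 - m%:R * t)))
  @[t --> at_side b x] --> _).
  apply: near_eq_cvg; near=> t.
  have [|t01 dt] := near nd t; first by [].
  by rewrite [RHS](errsumS _ t01) /pierceT dt.
apply: cvgN; apply: cvgMr; apply: cvgD; last exact: cvg_comp ca cl.
apply: cvg_trans ca _; case: (~~ b); exact: cvg_within.
Unshelve. all: by end_near. Qed.

Lemma errsum_0 {R : realType} : errsum (0 : R) = 0.
Proof.
have := errsum_bound (0 : R); rewrite lexx ler01 mulr0 => /(_ isT).
by rewrite normr_le0 => /eqP.
Qed.

Lemma errsum_right0 {R : realType} :
  errsum t @[t --> at_side false (0 : R)] --> (0 : R).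
Proof.
rewrite /at_side; apply/norm_cvg0P.
apply: (@squeeze_cvgr _ _ _ _ (fun=> 0) (fun t => 2 * t)).
- near=> t; rewrite normr_ge0 /= errsum_bound //; apply/andP; split.
    by apply: ltW; near: t; exact: nbhs_right_gt.
  by apply: ltW; near: t; exact: nbhs_right_lt.
- exact: cvg_cst.
- apply: cvg_at_right_filter.
  suff : 2 * t @[t --> (0 : R)] --> 2 * (0 : R) by rewrite mulr0.
  by apply: cvgMr; exact: cvg_id.
Unshelve. all: by end_near. Qed.

Lemma jump_size_tail {R : realType} (x : R) n :
  jump_size n.+2 x = invNinf R (d1 x) * jump_size n.+1 (pierceT x).
Proof.
have digitS k : digit k.+2 x = digit k.+1 (pierceT x).
  by rewrite /digit /= -iterSr.
rewrite /jump_size !digitS -invNinfM !big_add1 /= big_nat_recl //.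
congr invNinf; rewrite -!mulNinfA; congr mulNinf.
by congr mulNinf; apply: eq_bigr => k _; rewrite digitS.
Qed.

(** The expansion has length [n.+1], so [~~ odd n] is the side on which E is
    continuous: the left one when the length is odd. *)
Lemma errsum_limits {R : realType} n (x : R) :
  0 < x < 1 -> finite_pierce n.+1 x ->
  (errsum t @[t --> at_side (~~ odd n) x] --> errsum x) /\
  (errsum t @[t --> at_side (odd n) x] -->
     errsum x + (-1) ^+ n.+1 * jump_size n.+1 x).
Proof.
elim: n x => [|n IH] x /andP[x0 x1] [fin inf].
- (* x = 1/m, where two branches of T meet *)
  have [|m dx [Tx _ _ _]] := pierceT_itv x; first by rewrite x0 ltW.
  have x01 : 0 <= x <= 1 by rewrite !ltW.
  have T0 : pierceT x = 0 by exact: d1_eq_None (inf 2%N isT).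
  have mx : m.+1%:R * x = 1 by apply/eqP; rewrite eq_sym -subr_eq0 -Tx T0.
  case: m dx Tx mx => [|m] dx Tx mx; first by move: x1; rewrite -mx mul1r ltxx.
  have Ex : errsum x = 0.
    by rewrite errsumS // T0 errsum_0 addr0 mulr0 oppr0.
  have cl : errsum t @[t --> at_side true x] --> errsum x.
    rewrite errsumS // dx Tx.
    apply: errsum_branch => //.
      by rewrite /side_in_branch mx lexx /= -natr1 mulrDl mx mul1r ltrDl.
    by rewrite -Tx T0 errsum_0; exact: errsum_right0.
  split=> //=.
  (* the branch on the right of x = 1/(m+2) has index m+1 and fixes x, so its
     limit comes from the left limit at x, just computed *)
  have hx : 1 - m.+1%:R * x = x.
    by move: mx; rewrite -(@natr1 _ m.+1); lra.
  have := @errsum_branch R false x (errsum x) m.+1 isT.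
  rewrite hx Ex => /(_ _ _) c.
  have -> : 0 + (-1) ^+ 1 * jump_size 1 x = - (m.+1%:R^-1 * (x + 0)).
    rewrite add0r expr1 mulN1r addr0 /jump_size big_geq // [digit 1 x]dx /=.
    rewrite mul1n natrM invfM; congr (- (_ * _)).
    by apply: (mulfI (x := m.+2%:R)); rewrite ?mx ?mulfV // pnatr_eq0.
  apply: c; last by rewrite Ex in cl.
  rewrite /side_in_branch mx lexx andbT.
  by move: mx; rewrite -(@natr1 _ m.+1); lra.
- (* x is interior to a branch, since T x is nonzero *)
  have [|m dx [Tx T0 Tlt _]] := pierceT_itv x; first by rewrite x0 ltW.
  have x01 : 0 <= x <= 1 by rewrite !ltW.
  have /andP[d_le d_gt] := (d1P x _ x0).1 dx.
  have Tp : 0 < pierceT x.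
    rewrite lt0r T0 andbT; apply/eqP => T0'.
    by apply: (fin 2%N isT); rewrite /digit /= T0' d1_0.
  have mx : m.+1%:R * x < 1 by rewrite -subr_gt0 -Tx.
  have [||c1 c2] := IH (pierceT x); first by rewrite Tp (lt_trans Tlt).
    split=> k hk; have -> : digit k (pierceT x) = digit k.+1 x
      by case: k hk => // k _; rewrite /digit /= -iterSr.
    + by apply: fin; case/andP: hk.
    + by apply: inf.
  rewrite jump_size_tail errsumS // dx /=.
  have side b : side_in_branch b x m.+1.
    by case: b; rewrite /side_in_branch ?mx ?(ltW mx) ?d_gt ?(ltW d_gt).
  rewrite negbK; split.
  + rewrite Tx; apply: errsum_branch => //.
    by rewrite -Tx; exact: c1.
  + rewrite (_ : _ + _ = - (m.+1%:R^-1 * (1 - m.+1%:R * x +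
      (errsum (pierceT x) +
       (-1) ^+ n.+1 * jump_size n.+1 (pierceT x))))); last first.
      by rewrite [(-1) ^+ n.+2]exprS Tx; ring.
    apply: errsum_branch => //.
    by rewrite -Tx negbK; exact: c2.
Qed.

(** * Sequences of finite length *)
Lemma phi_partS {R : realType} (s : Nseq) n :
  phi_part R s n.+1 = phi_part R s n + phi_term R s n.+1.
Proof. by rewrite /phi_part big_nat_recr. Qed.

Lemma phi_part_stable {R : realType} (s : Nseq) N n :
  (forall k, (N <= k)%N -> s k = None) -> (N <= n)%N ->
  phi_part R s n = phi_part R s N.
Proof.
move=> sN Nn; rewrite /phi_part (big_cat_nat (n := N.+1)) //=.
rewrite [X in _ + X]big_nat_cond.
rewrite [X in _ + X]big1 ?addr0 // => k /andP[/andP[Nk _] _].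
case: k Nk => // k Nk; rewrite /phi_term big_nat_recr //= sN //.
by case: (\big[_/_]_(0 <= i < k) s i) => [a|] /=; rewrite mulr0.
Qed.

Lemma phi_stable {R : realType} (s : Nseq) N :
  (forall k, (N <= k)%N -> s k = None) -> phi R s = phi_part R s N.
Proof.
move=> sN; apply: lim_sum_from1; apply: cvg_near_cst; near=> n.
apply: phi_part_stable => //; near: n; exact: nbhs_infty_ge.
Unshelve. all: by end_near. Qed.

Lemma Estar_stable {R : realType} (s : Nseq) N :
  (forall k, (N <= k)%N -> s k = None) ->
  Estar R s = \sum_(1 <= k < N.+1) (phi R s - phi_part R s k).
Proof.
move=> sN; apply: lim_sum_from1; apply: cvg_near_cst; near=> n.
have Nn : (N <= n)%N by near: n; exact: nbhs_infty_ge.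
rewrite (big_cat_nat (n := N.+1)) //= [X in _ + X]big_nat_cond.
rewrite [X in _ + X]big1 ?addr0 // => k /andP[/andP[Nk _] _].
by rewrite (phi_stable s N) // (phi_part_stable s N k) ?subrr // ltnW.
Unshelve. all: by end_near. Qed.

(** * The second sequence over a finite expansion *)

(** For s of length [n.+1], so with last digit [s n = d], this is the sequence
    of length [n.+2] that ends with d - 1, d. *)
Definition twin (n : nat) (s : Nseq) : Nseq := fun k =>
  if (k < n)%N then s k else if k == n then predNinf (s n)
  else if k == n.+1 then s n else None.

Lemma big_twin n s k : (k <= n)%N ->
  \big[mulNinf/Some 1%N]_(0 <= i < k) twin n s i =
  \big[mulNinf/Some 1%N]_(0 <= i < k) s i.
Proof.
move=> kn; apply: eq_big_nat => i /andP[_ ik].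
by rewrite /twin (leq_trans ik kn).
Qed.

Lemma phi_part_twin {R : realType} n s k : (k <= n)%N ->
  phi_part R (twin n s) k = phi_part R s k.
Proof.
move=> kn; apply: eq_big_nat => i /andP[_ ik].
by rewrite /phi_term big_twin // -ltnS (leq_trans ik).
Qed.

Lemma phi_term_twin_last {R : realType} (x : R) n :
  phi_term R (twin n (digits x)) n.+2 = (-1) ^+ n.+1 * jump_size n.+1 x.
Proof.
rewrite /phi_term /jump_size big_add1 /= !big_nat_recr //= big_twin //.
rewrite /twin !ltnNge !leqnSn leqnn /= eqxx eqn_leq ltnn /= eqxx.
by rewrite !exprS !mulN1r opprK.
Qed.

(** This is 1/(m+1) - 1/((m+1) (m+2)) = 1/(m+2), times a common factor. *)
Lemma phi_part_twin_last {R : realType} n s m : s n = Some m.+2 ->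
  phi_part R (twin n s) n.+2 = phi_part R s n.+1.
Proof.
move=> sn; rewrite !phi_partS phi_part_twin //.
rewrite -addrA; congr (_ + _); rewrite /phi_term !big_nat_recr //=.
rewrite big_twin // sn /twin !ltnNge !leqnSn leqnn /= eqxx eqn_leq ltnn /= eqxx.
rewrite sn !invNinfM /=.
rewrite [(-1) ^+ n.+3]exprS mulN1r /=.
set P := invNinf R _; set e := _ ^+ _.
by field; rewrite nat1r -natrD !pnatr_eq0.
Qed.

(** If T x = 1/b exactly, then T x < 1/(a+1) forces b > a + 1. So b - 1 still
    exceeds a, and the twin sequence is increasing. *)
Lemma d1_last_gap {R : realType} (x : R) a b : 0 < x <= 1 ->
  d1 x = Some a -> d1 (pierceT x) = Some b -> d1 (pierceT (pierceT x)) = None ->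
  (a.+1 < b)%N.
Proof.
move=> x01 dx dy /d1_eq_None T2.
have [m] := pierceT_itv x x01; rewrite dx => -[->] [_ T0 Tx hm].
have y01 : 0 < pierceT x <= 1.
  rewrite lt0r T0 (le_trans (ltW Tx)) ?andbT; last by case/andP: x01.
  by apply/eqP => y0; move: dy; rewrite y0 d1_0.
have [b'] := pierceT_itv _ y01; rewrite dy => -[->] [Ty _ _ _].
have by1 : b'.+1%:R * pierceT x = 1.
  by apply/eqP; rewrite eq_sym -subr_eq0 -Ty T2.
by move: hm; rewrite -[X in _ < X]by1 ltr_pM2r ?ltr_nat //; case/andP: y01.
Qed.

Lemma digits_iter {R : realType} (x : R) i k :
  digits x (i + k)%N = digits (iter k (@pierceT R) x) i.
Proof. by rewrite /digits /digit /= iterD. Qed.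

Lemma iter_pierceT01 {R : realType} (x : R) k : 0 <= x <= 1 ->
  0 <= iter k (@pierceT R) x <= 1.
Proof. by move=> x01; elim: k => //= k; exact: pierceT01. Qed.


(** Lowering the last digit keeps the sequence increasing by [d1_last_gap], and
    keeps it positive in length 1 because x = 1 is excluded. *)
Lemma twin_Sigma {R : realType} (x : R) n : 0 < x < 1 ->
  Sigma_fin n.+1 (digits x) -> Sigma_fin n.+2 (twin n (digits x)).
Proof.
move=> /andP[x0 x1] [a [a0 a_lt ad]].
have x01 : 0 <= x <= 1 by rewrite !ltW.
have dn : digits x n = Some (a n) by rewrite ad leqnn.
have dS : digits x n.+1 = None by rewrite ad ltnn.
have gap i : (i < n)%N -> (a i < (a n).-1)%N.
  case: n a0 a_lt ad dn dS => // n a0 a_lt ad dn dS.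
  have g : (a n < (a n.+1).-1)%N.
    have dn' : digits x n = Some (a n) by rewrite ad leqnSn.
    pose y := iter n (@pierceT R) x.
    have y01 : 0 < y <= 1.
      have /andP[y0 ->] := iter_pierceT01 x n x01.
      rewrite lt0r y0 !andbT; apply/eqP => yz.
      by move: dn'; rewrite -[n]add0n digits_iter -/y yz digits_0.
    rewrite ltn_predRL; apply: (d1_last_gap y) => //.
  rewrite ltnS leq_eqVlt => /predU1P[->//|i_n]; apply: ltn_trans g.
  by apply: a_lt; rewrite i_n /=.
have pos : (0 < (a n).-1)%N.
  case: n a0 a_lt ad dn dS gap => [|n] a0 a_lt ad dn dS gap.
    have [|m dx [Tx _ _ _]] := pierceT_itv x; first by rewrite x0 ltW.
    move: dn; rewrite [digits x 0]dx => -[<-] /=.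
    move: dS => /d1_eq_None /= T0.
    rewrite lt0n; apply/eqP => m0; move: Tx x1.
    rewrite T0 m0 mul1r => /eqP.
    by rewrite eq_sym subr_eq0 => /eqP<-; rewrite ltxx.
  exact: leq_ltn_trans (gap 0%N isT).
exists (fun k =>
  if (k < n)%N then a k else if k == n then (a n).-1 else a n); split.
- move=> k _; case: (ltnP k n) => [kn|_]; first by apply: a0; rewrite ltnS ltnW.
  by case: eqP => _; [exact: pos|apply: a0; rewrite ltnS].
- move=> i j /andP[ij]; rewrite ltnS leq_eqVlt => /predU1P[jn|].
    have [-> ->] : (j < n)%N = false /\ (j == n) = false.
      by rewrite jn; split; lia.
    case: (ltngtP i n) => [i_n|n_i|_]; first by apply: a_lt; rewrite i_n /=.
      by move: ij; rewrite jn; lia.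
    by move: pos; case: (a n).
  rewrite ltnS leq_eqVlt => /predU1P[jn|jn].
    by subst j; rewrite ltnn eqxx ij; exact: gap.
  by rewrite jn (ltn_trans ij jn); apply: a_lt; rewrite ij ltnW.
- move=> k; rewrite /twin; case: (ltngtP k n) => [kn|nk|->].
  + have -> : (k < n.+2)%N by lia.
    by rewrite ad ltnS (ltnW kn).
  + by rewrite ltnS leq_eqVlt (ltnNge k) nk orbF dn.
  + by rewrite ltnS leqnSn dn.
Qed.


Lemma realizable_digits {R : realType} (s : Nseq) :
  realizable R s -> s = digits (phi R s).
Proof.
move=> [y y01 ys]; have -> : s = digits y by apply/funext => k; rewrite ys.
by rewrite phi_digits.
Qed.

Lemma twin_inj n s : s n.+1 = None -> s n <> None -> twin n s <> s.
Proof.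
move=> sS sn /(congr1 (@^~ n.+1)); rewrite sS /twin ltnNge leqnSn /=.
rewrite eqn_leq ltnn /=.
by rewrite eqxx.
Qed.

(** The jump is one over the product of the digits of the twin sequence. *)
Lemma jump_size_gt0 {R : realType} n (x : R) :
  Sigma_fin n.+2 (twin n (digits x)) -> 0 < jump_size n.+1 x.
Proof.
move=> [a [a0 _ sa]].
have -> : jump_size n.+1 x =
    invNinf R (\big[mulNinf/Some 1%N]_(0 <= i < n.+2) twin n (digits x) i).
  have := @phi_term_twin_last R x n.
  rewrite /phi_term !exprS !mulN1r opprK => /mulfI ->//.
  by rewrite ?oppr_eq0 expf_neq0 // oppr_eq0 oner_eq0.
suff [p p0 ->] : exists2 p, (0 < p)%N &
    \big[mulNinf/Some 1%N]_(0 <= i < n.+2) twin n (digits x) i = Some p.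
  by rewrite /= invr_gt0 ltr0n.
rewrite big_nat_cond.
elim/big_ind: _ => [|u v [p p0 ->] [q q0 ->]|i /andP[/andP[_ i_n] _]].
- by exists 1%N.
- by exists (p * q)%N => //; rewrite muln_gt0 p0.
- by exists (a i); [exact: a0|rewrite sa i_n].
Qed.

(** The partial sums of index at most n agree, and those of index at least
    [n.+2] are both x. At index [n.+1] the digits of x already give x, while
    the twin sequence misses its last term. *)
Lemma Estar_twin {R : realType} n (x : R) : 0 <= x <= 1 ->
  Sigma_fin n.+1 (digits x) -> phi R (twin n (digits x)) = x ->
  Estar R (twin n (digits x)) = errsum x + (-1) ^+ n.+1 * jump_size n.+1 x.
Proof.
move=> x01 [a [_ _ ad]] ph.
have sN k : (n.+1 <= k)%N -> digits x k = None by move=> h; rewrite ad ltnNge h.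
have tN k : (n.+2 <= k)%N -> twin n (digits x) k = None.
  move=> h; rewrite /twin.
  have [-> -> ->] :
      [/\ (k < n)%N = false, (k == n) = false & (k == n.+1) = false].
    by split; lia.
  by [].
have Ed : errsum x = Estar R (digits x) by rewrite /Estar phi_digits.
have pt : phi_part R (twin n (digits x)) n.+2 = x.
  by rewrite -(phi_stable _ n.+2 tN).
have pd : phi_part R (digits x) n.+1 = x.
  by rewrite -(phi_stable _ n.+1 sN) phi_digits.
rewrite Ed (Estar_stable _ n.+2 tN) (Estar_stable _ n.+1 sN) ph phi_digits //.
rewrite (@big_nat_recr _ _ _ n.+2) //= !(@big_nat_recr _ _ _ n.+1) //= pt pd.
rewrite subrr !addr0 -phi_term_twin_last; congr (_ + _).
  by apply: eq_big_nat => k /andP[_ kn]; rewrite phi_part_twin.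
move: pt; rewrite phi_partS.
set u := phi_part _ _ _; set v := phi_term _ _ _ => uv.
by apply/eqP; rewrite subr_eq addrC uv.
Qed.

(** * The theorem *)
Theorem theorem3p18 (R : realType) (x : R) (n : nat) (sigma sigma' : Nseq)
    (hx : rat_unit_interval x) (hn : (1 <= n)%N)
    (hpre : phi_preimage x = [set sigma; sigma'])
    (hsigma : Sigma_fin n sigma) (hreal : realizable R sigma)
    (hsigma' : Sigma_fin n.+1 sigma') (hnreal : ~ realizable R sigma')
    (hexp : finite_pierce n x) :
  (odd n ->
    (left_continuous_at (@errsum R) x /\ right_jump_at (@errsum R) x) /\
    [/\ errsum t @[t --> x^'-] --> Estar R sigma,
        Estar R sigma = errsum x,
        errsum t @[t --> x^'+] --> Estar R sigma' &
        Estar R sigma' = errsum x - jump_size n x]) /\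
  (~~ odd n ->
    (right_continuous_at (@errsum R) x /\ left_jump_at (@errsum R) x) /\
    [/\ errsum t @[t --> x^'+] --> Estar R sigma,
        Estar R sigma = errsum x,
        errsum t @[t --> x^'-] --> Estar R sigma' &
        Estar R sigma' = errsum x + jump_size n x]).
Proof.
case: hx => /= x_in _; have x01 : 0 <= x <= 1.
  by case/andP: x_in => /ltW -> /ltW ->.
case: n hn hsigma hsigma' hexp => // n _ hsigma hsigma' hexp.
have [_ phs] : phi_preimage x sigma by rewrite hpre; left.
have ds : sigma = digits x by rewrite -phs; exact: realizable_digits.
rewrite {phs hreal}ds in hpre hsigma *.
have tS := twin_Sigma x n x_in hsigma.
have [a [a0 a_lt ad]] := hsigma.
have dN k : (n.+1 <= k)%N -> digits x k = None by move=> h; rewrite ad ltnNge h.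
have tN k : (n.+2 <= k)%N -> twin n (digits x) k = None.
  by case: tS => b [_ _ tb] h; rewrite tb ltnNge h.
have dn : digits x n = Some (a n) by rewrite ad leqnn.
have an : (1 < a n)%N.
  case: tS => b [b0 _ tb]; have := tb n; rewrite /twin ltnn eqxx dn leqnSn /=.
  by move=> [an]; have := b0 n (leqnSn _); rewrite -an; case: (a n) => [|[]].
have pht : phi R (twin n (digits x)) = x.
  rewrite (phi_stable _ n.+2 tN) (phi_part_twin_last n _ (a n).-2).
    by rewrite -(phi_stable _ n.+1 dN) phi_digits.
  by rewrite dn; case: (a n) an => [|[]].
(* only two sequences lie over x, and the twin is not the digit sequence *)
have ts : sigma' = twin n (digits x).
  have : phi_preimage x (twin n (digits x)) by split => //; left; exists n.+2.
  rewrite hpre => -[/twin_inj|//].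
  by case; [exact: dN|rewrite dn].
rewrite {}ts in hpre hsigma' hnreal *.
have [c1 c2] := errsum_limits n x x_in hexp.
have J0 := jump_size_gt0 n x tS.
have Es : Estar R (digits x) = errsum x by rewrite /Estar phi_digits.
have Et := Estar_twin n x x01 hsigma pht.
rewrite /left_continuous_at /right_continuous_at /right_jump_at /left_jump_at.
rewrite Es -signr_odd /= in c1 c2 Et *.
split=> /= od; [|move: od; rewrite negbK => od];
  rewrite ?(negbTE od) ?od /= in c1 c2 Et;
  rewrite ?expr0 ?expr1 ?mulN1r ?mul1r in c2 Et; rewrite Et.
- split; first by split=> //; exists (errsum x - jump_size n.+1 x) => //; lra.
  by split.
- split; first by split=> //; exists (errsum x + jump_size n.+1 x) => //; lra.
  by split.
Qed.
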